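(* Let $l>0$ be a mesh level, let $x_i,x_j$ be two spatial points, and let $u^{h_l}_i,u^{h_l}_j,u^{h_{l-1}}_i,u^{h_{l-1}}_j$ be the finite-variance random variables given by the values at $x_i$ and $x_j$ of the spatially discretized random solution on the meshes of levels $l$ and $l-1$ (see the context). Let $N=N_l>3$ be the number of samples on level $l$, and let $\omega_1,\dots,\omega_N$ be independent sample points, the same sample points being used on both levels. For non-negative integers $a,b,c,d$ let $$s_{a,b,c,d}=\sum_{k=1}^{N}u^{h_l}_i(\omega_k)^a\, u^{h_l}_j(\omega_k)^b\, u^{h_{l-1}}_i(\omega_k)^c\, u^{h_{l-1}}_j(\omega_k)^d ,$$ and let $$Z_l=\frac{N s_{1,1,0,0}-s_{0,1,0,0}s_{1,0,0,0}}{(N-1)N}-\frac{N s_{0,0,1,1}-s_{0,0,0,1}s_{0,0,1,0}}{(N-1)N}.$$ Define $$\widehat{\mathrm{Var}}^{\mathrm{MC}}(Z_l)=\frac{B}{(N-3)(N-2)(N-1)^2N^2},$$ where $$\begin{aligned} B={}& s_{0,0,2,2}N^4-2s_{1,1,1,1}N^4+s_{2,2,0,0}N^4-s_{0,0,1,1}^2N^3-s_{1,1,0,0}^2N^3\\ &-2s_{0,0,1,0}s_{0,0,1,2}N^3-2s_{0,0,2,2}N^3+2s_{0,1,1,1}s_{1,0,0,0}N^3+2s_{0,1,0,0}s_{1,0,1,1}N^3\\ &+2s_{0,0,1,1}s_{1,1,0,0}N^3+2s_{0,0,1,0}s_{1,1,0,1}N^3+4s_{1,1,1,1}N^3-2s_{1,0,0,0}s_{1,2,0,0}N^3\\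 &-2s_{0,1,0,0}s_{2,1,0,0}N^3-2s_{2,2,0,0}N^3+s_{0,0,1,1}^2N^2+s_{0,2,0,0}s_{1,0,0,0}^2N^2\\ &+s_{1,1,0,0}^2N^2+4s_{0,0,1,0}s_{0,0,1,2}N^2+s_{0,0,2,2}N^2-4s_{0,0,1,1}s_{0,1,0,0}s_{1,0,0,0}N^2\\ &-2s_{0,0,1,0}s_{0,1,0,1}s_{1,0,0,0}N^2-4s_{0,1,1,1}s_{1,0,0,0}N^2-2s_{0,0,1,0}s_{0,1,0,0}s_{1,0,0,1}N^2\\ &+2s_{0,1,1,0}s_{1,0,0,1}N^2+2s_{0,1,0,1}s_{1,0,1,0}N^2-4s_{0,1,0,0}s_{1,0,1,1}N^2\\ &-4s_{0,0,1,1}s_{1,1,0,0}N^2+6s_{0,1,0,0}s_{1,0,0,0}s_{1,1,0,0}N^2-4s_{0,0,1,0}s_{1,1,0,1}N^2-2s_{1,1,1,1}N^2\\ &+4s_{1,0,0,0}s_{1,2,0,0}N^2+s_{0,1,0,0}^2s_{2,0,0,0}N^2-s_{0,2,0,0}s_{2,0,0,0}N^2+4s_{0,1,0,0}s_{2,1,0,0}N^2\\ &+s_{2,2,0,0}N^2+2s_{0,0,1,1}^2N-4s_{0,1,0,0}^2s_{1,0,0,0}^2N-s_{0,2,0,0}s_{1,0,0,0}^2N\\ &+2s_{1,1,0,0}^2N-2s_{0,0,1,0}s_{0,0,1,2}N+(N-1)s_{0,0,0,2}\big(s_{0,0,1,0}^2-s_{0,0,2,0}\big)N\\ &+8s_{0,0,1,1}s_{0,1,0,0}s_{1,0,0,0}N+2s_{0,0,1,0}s_{0,1,0,1}s_{1,0,0,0}N+2s_{0,1,1,1}s_{1,0,0,0}N\\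 &+2s_{0,0,1,0}s_{0,1,0,0}s_{1,0,0,1}N-2s_{0,1,1,0}s_{1,0,0,1}N-2s_{0,1,0,1}s_{1,0,1,0}N\\ &+2s_{0,1,0,0}s_{1,0,1,1}N-2s_{0,0,1,1}s_{1,1,0,0}N-10s_{0,1,0,0}s_{1,0,0,0}s_{1,1,0,0}N\\ &+2s_{0,0,1,0}s_{1,1,0,1}N-2s_{1,0,0,0}s_{1,2,0,0}N-s_{0,1,0,0}^2s_{2,0,0,0}N\\ &+s_{0,2,0,0}s_{2,0,0,0}N-2s_{0,1,0,0}s_{2,1,0,0}N+6s_{0,1,0,0}^2s_{1,0,0,0}^2\\ &+s_{0,0,0,1}^2\big((6-4N)s_{0,0,1,0}^2+(N-1)N s_{0,0,2,0}\big)\\ &-2s_{0,0,0,1}\Big(s_{0,0,1,0}\big(N(5-3N)s_{0,0,1,1}+2(3-2N)s_{0,1,0,0}s_{1,0,0,0}+2(N-2)N s_{1,1,0,0}\big)\\ &\qquad+(N-1)N\big((N-1)s_{0,0,2,1}+s_{0,1,1,0}s_{1,0,0,0}+s_{0,1,0,0}s_{1,0,1,0}-N s_{1,1,1,0}+s_{1,1,1,0}\big)\Big). \end{aligned}$$ Then $\widehat{\mathrm{Var}}^{\mathrm{MC}}(Z_l)$ is an unbiased estimator of the variance of $Z_l$, that is, $$\mathbb{E}\big(\widehat{\mathrm{Var}}^{\mathrm{MC}}(Z_l)\big)=\mathrm{Var}(Z_l).$$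
   Context: Let $(\Omega,\mathfrak{F},\mathbb{P})$ be a probability space and $\mathcal{G}\subset\mathbb{R}^d$ a spatial domain. A random field $u(x,\omega)$, $x\in\mathcal{G}$, $\omega\in\Omega$, solves a stochastic equation $\mathcal{A}(q(\omega),u(x,\omega))=f(x)$, where $\mathcal{A}$ is a (possibly nonlinear) operator, $q$ is a random parameter with finite second-order moments, and $f$ is a given load; the solution is square integrable with respect to $\mathbb{P}$. On a sequence of nested meshes of levels $l=0,1,\dots,L$ with decreasing element sizes $h_l$, $u^{h_l}(x,\omega)$ denotes the spatially discretized (for example, finite element) solution on level $l$, and $u^{h_l}_i(\omega)=u^{h_l}(x_i,\omega)$, $u^{h_l}_j(\omega)=u^{h_l}(x_j,\omega)$ are its values at the spatial points $x_i,x_j$, which are finite-variance random variables. For $l>0$, $Z_l$ is the difference of the Monte Carlo covariance estimators of $(u^{h_l}_i,u^{h_l}_j)$ and of $(u^{h_{l-1}}_i,u^{h_{l-1}}_j)$, both computed from the same $N_l$ random samples; the values on the two levels are therefore in general strongly correlated. $\mathbb{E}$ denotes the expectation and $\mathrm{Var}(Z)=\mathbb{E}((Z-\mathbb{E}(Z))^2)$. The abbreviation $N=N_l$ is used throughout. *)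

(* Defs.v *)
From HB Require Import structures.
From mathcomp Require Import all_boot all_order all_algebra.
From mathcomp Require Import all_classical all_reals all_analysis.

Set Implicit Arguments.
Unset Strict Implicit.
Unset Printing Implicit Defensive.

Import Order.TTheory GRing.Theory Num.Theory.
Import numFieldNormedType.Exports.

Local Open Scope classical_set_scope.
Local Open Scope ring_scope.

(* Although ['V_P[X]] is centred at [fine 'E_P[X]], it is finite only for      *)
(* square-integrable [X]: [E (X - c)^2 < +oo] for some real [c] already forces *)
(* [E X^2 < +oo], since [P] is a probability.                                  *)
Definition finite_variance d (T : measurableType d) (R : realType)
    (P : probability T R) (X : T -> R) : Prop :=
  measurable_fun setT X /\ ('V_P[X] < +oo)%E.

Definition mutually_independent d d' (T : measurableType d)
    (T' : measurableType d') (R : realType) (Q : probability T R) (N : nat)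
    (w : 'I_N -> {RV Q >-> T'}) : Prop :=
  forall (J : {set 'I_N}) (A : 'I_N -> set T'),
    (forall k, k \in J -> measurable (A k)) ->
    Q (\bigcap_(k in [set` J]) (w k @^-1` A k)) =
    (\prod_(k in J) Q (w k @^-1` A k))%E.

(* The sample points live on their own probability space [(T, Q)]; each of     *)
(* them is a random element of [T'] with law [P].                              *)
Definition independent_samples d d' (T : measurableType d)
    (T' : measurableType d') (R : realType) (Q : probability T R)
    (P : probability T' R) (N : nat) (w : 'I_N -> {RV Q >-> T'}) : Prop :=
  (forall k A, measurable A -> distribution Q (w k) A = P A) /\
  mutually_independent w.

(* The first two families are the values at the two points on the fine level,  *)
(* the last two the values at the same points on the coarse level.             *)
Definition power_sum (R : realType) (N : nat) (fi fj ci cj : 'I_N -> R)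
    (a b c d : nat) : R :=
  \sum_(k < N) fi k ^+ a * fj k ^+ b * ci k ^+ c * cj k ^+ d.

Section Estimators.
Variables (R : realType) (N : nat) (s : nat -> nat -> nat -> nat -> R).

Local Notation n := (N%:R : R).
Local Notation "s_[ a , b , c , d ]" := (s a%N b%N c%N d%N)
  (at level 0, format "s_[ a , b , c , d ]").

(* [s_[a,b,c,d]] is the power sum with exponents [a], [b] on the fine level    *)
(* and [c], [d] on the coarse one.                                             *)
Definition level_covariance_difference : R :=
  (n * s_[1,1,0,0] - s_[0,1,0,0] * s_[1,0,0,0]) / ((n - 1) * n)
  - (n * s_[0,0,1,1] - s_[0,0,0,1] * s_[0,0,1,0]) / ((n - 1) * n).

Definition variance_numerator : R :=
  s_[0,0,2,2] * n ^+ 4 - 2 * s_[1,1,1,1] * n ^+ 4 + s_[2,2,0,0] * n ^+ 4 -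
    s_[0,0,1,1] ^+ 2 * n ^+ 3 - s_[1,1,0,0] ^+ 2 * n ^+ 3
  - 2 * s_[0,0,1,0] * s_[0,0,1,2] * n ^+ 3 - 2 * s_[0,0,2,2] * n ^+ 3 +
    2 * s_[0,1,1,1] * s_[1,0,0,0] * n ^+ 3 +
    2 * s_[0,1,0,0] * s_[1,0,1,1] * n ^+ 3
  + 2 * s_[0,0,1,1] * s_[1,1,0,0] * n ^+ 3 +
    2 * s_[0,0,1,0] * s_[1,1,0,1] * n ^+ 3 + 4 * s_[1,1,1,1] * n ^+ 3 -
    2 * s_[1,0,0,0] * s_[1,2,0,0] * n ^+ 3
  - 2 * s_[0,1,0,0] * s_[2,1,0,0] * n ^+ 3 - 2 * s_[2,2,0,0] * n ^+ 3 +
    s_[0,0,1,1] ^+ 2 * n ^+ 2 + s_[0,2,0,0] * s_[1,0,0,0] ^+ 2 * n ^+ 2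
  + s_[1,1,0,0] ^+ 2 * n ^+ 2 + 4 * s_[0,0,1,0] * s_[0,0,1,2] * n ^+ 2 +
    s_[0,0,2,2] * n ^+ 2 -
    4 * s_[0,0,1,1] * s_[0,1,0,0] * s_[1,0,0,0] * n ^+ 2
  - 2 * s_[0,0,1,0] * s_[0,1,0,1] * s_[1,0,0,0] * n ^+ 2 -
    4 * s_[0,1,1,1] * s_[1,0,0,0] * n ^+ 2 -
    2 * s_[0,0,1,0] * s_[0,1,0,0] * s_[1,0,0,1] * n ^+ 2
  + 2 * s_[0,1,1,0] * s_[1,0,0,1] * n ^+ 2 +
    2 * s_[0,1,0,1] * s_[1,0,1,0] * n ^+ 2 -
    4 * s_[0,1,0,0] * s_[1,0,1,1] * n ^+ 2
  - 4 * s_[0,0,1,1] * s_[1,1,0,0] * n ^+ 2 +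
    6 * s_[0,1,0,0] * s_[1,0,0,0] * s_[1,1,0,0] * n ^+ 2 -
    4 * s_[0,0,1,0] * s_[1,1,0,1] * n ^+ 2 - 2 * s_[1,1,1,1] * n ^+ 2
  + 4 * s_[1,0,0,0] * s_[1,2,0,0] * n ^+ 2 +
    s_[0,1,0,0] ^+ 2 * s_[2,0,0,0] * n ^+ 2 -
    s_[0,2,0,0] * s_[2,0,0,0] * n ^+ 2 +
    4 * s_[0,1,0,0] * s_[2,1,0,0] * n ^+ 2
  + s_[2,2,0,0] * n ^+ 2 + 2 * s_[0,0,1,1] ^+ 2 * n -
    4 * s_[0,1,0,0] ^+ 2 * s_[1,0,0,0] ^+ 2 * n -
    s_[0,2,0,0] * s_[1,0,0,0] ^+ 2 * n
  + 2 * s_[1,1,0,0] ^+ 2 * n - 2 * s_[0,0,1,0] * s_[0,0,1,2] * n +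
    (n - 1) * s_[0,0,0,2] * (s_[0,0,1,0] ^+ 2 - s_[0,0,2,0]) * n
  + 8 * s_[0,0,1,1] * s_[0,1,0,0] * s_[1,0,0,0] * n +
    2 * s_[0,0,1,0] * s_[0,1,0,1] * s_[1,0,0,0] * n +
    2 * s_[0,1,1,1] * s_[1,0,0,0] * n
  + 2 * s_[0,0,1,0] * s_[0,1,0,0] * s_[1,0,0,1] * n -
    2 * s_[0,1,1,0] * s_[1,0,0,1] * n - 2 * s_[0,1,0,1] * s_[1,0,1,0] * n
  + 2 * s_[0,1,0,0] * s_[1,0,1,1] * n - 2 * s_[0,0,1,1] * s_[1,1,0,0] * n -
    10 * s_[0,1,0,0] * s_[1,0,0,0] * s_[1,1,0,0] * n
  + 2 * s_[0,0,1,0] * s_[1,1,0,1] * n - 2 * s_[1,0,0,0] * s_[1,2,0,0] * n -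
    s_[0,1,0,0] ^+ 2 * s_[2,0,0,0] * n
  + s_[0,2,0,0] * s_[2,0,0,0] * n - 2 * s_[0,1,0,0] * s_[2,1,0,0] * n +
    6 * s_[0,1,0,0] ^+ 2 * s_[1,0,0,0] ^+ 2
  + s_[0,0,0,1] ^+ 2 * ((6 - 4 * n) * s_[0,0,1,0] ^+ 2 +
    (n - 1) * n * s_[0,0,2,0])
  - 2 * s_[0,0,0,1] * (s_[0,0,1,0] * (n * (5 - 3 * n) * s_[0,0,1,1] +
    2 * (3 - 2 * n) * s_[0,1,0,0] * s_[1,0,0,0] +
    2 * (n - 2) * n * s_[1,1,0,0])
  + (n - 1) * n * ((n - 1) * s_[0,0,2,1] + s_[0,1,1,0] * s_[1,0,0,0] +
    s_[0,1,0,0] * s_[1,0,1,0] - n * s_[1,1,1,0] + s_[1,1,1,0])).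

Definition mc_variance_estimator : R :=
  variance_numerator
  / ((n - 3) * (n - 2) * (n - 1) ^+ 2 * n ^+ 2).

End Estimators.

(* Main.v *)
Require Import Defs.
From HB Require Import structures.
From mathcomp Require Import all_boot all_order all_algebra.
From mathcomp Require Import all_classical all_reals all_analysis.
From mathcomp Require Import measurable_realfun.
From mathcomp Require Import zify ring lra.

Set Implicit Arguments.
Unset Strict Implicit.
Unset Printing Implicit Defensive.

Import Order.TTheory GRing.Theory Num.Theory.
Import numFieldNormedType.Exports.

Local Open Scope classical_set_scope.
Local Open Scope ring_scope.

(** Write [D = x y - x' y'] for the difference of the products on the two
levels, and [g k l = D_k - (x_k y_l - x'_k y'_l)] where the subscripts are
sample indices.  The estimator [Z] of the level difference of covariances is
the average of [g k l] over the pairs of distinct indices, so that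
[E Z = c := E (g k l)] for any [k <> l].  For four distinct indices
independence gives [E (g k l * g m p) = c ^ 2]; hence the average [U] of
[g k l * g m p] over the quadruples of distinct indices is an unbiased
estimator of [(E Z) ^ 2].  The numerator [variance_numerator] is an expansion
in power sums: the variance estimator equals [Z ^ 2 - U] identically in the
samples ([level_covariance_differenceE], [variance_numeratorE]).

Only second moments are assumed, so [Z ^ 2] and the variance estimator need not
be integrable, whereas [Z] and [U] are: [U] only multiplies integrable
functions of different samples ([has_mean_prod_samples]).  Therefore the
variance estimator is written as [(Z - c) ^ 2 + H], where
[H = 2 c Z - c ^ 2 - U] is integrable with integral zero.  Adding such an [H]
to a nonnegative function does not change its integral, even when this
integral is infinite ([integralD_ge0_mean0]), and the integral of
[(Z - c) ^ 2] is the variance of [Z]. *)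

(** * Sums over distinct indices *)

Section DistinctSums.
Variables (R : comNzRingType) (N : nat).
Implicit Type d : 'I_N -> R.
Local Notation n := (N%:R : R).

Definition distinct_sum2 (F : 'I_N -> 'I_N -> R) : R :=
  \sum_k \sum_(l | l != k) F k l.

Definition distinct_sum3 (F : 'I_N -> 'I_N -> 'I_N -> R) : R :=
  \sum_k \sum_(l | l != k) \sum_(m | (m != k) && (m != l)) F k l m.

Definition distinct_sum4 (F : 'I_N -> 'I_N -> 'I_N -> 'I_N -> R) : R :=
  \sum_k \sum_(l | l != k) \sum_(m | (m != k) && (m != l))
    \sum_(p | [&& p != k, p != l & p != m]) F k l m p.

Lemma sum_neq1 d k : \sum_(l | l != k) d l = \sum_l d l - d k.
Proof. by rewrite [in RHS](bigD1 k)//= [RHS]addrC addKr. Qed.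

Lemma sum_neq2 d k l : l != k ->
  \sum_(m | (m != k) && (m != l)) d m = \sum_m d m - d k - d l.
Proof.
by move=> lk; rewrite -sum_neq1 [in RHS](bigD1 l)//= [RHS]addrC addKr.
Qed.

Lemma sum_neq3 d k l m : l != k -> (m != k) && (m != l) ->
  \sum_(p | [&& p != k, p != l & p != m]) d p
  = \sum_p d p - d k - d l - d m.
Proof.
move=> lk mkl; rewrite -(sum_neq2 _ lk) [in RHS](bigD1 m)//= [RHS]addrC addKr.
by apply: eq_bigl => p; rewrite -andbA.
Qed.

Lemma sum_ord_cst (c : R) : \sum_(k < N) c = n * c.
Proof. by rewrite big_const_ord iter_addr_0 mulr_natl. Qed.

Lemma distinct_sum2_cst (c : R) :
  distinct_sum2 (fun _ _ : 'I_N => c) = n * (n - 1) * c.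
Proof.
rewrite /distinct_sum2.
under eq_bigr do rewrite sum_neq1.
by rewrite !sum_ord_cst; ring.
Qed.

Lemma distinct_sum4_cst (c : R) :
  distinct_sum4 (fun _ _ _ _ : 'I_N => c)
  = n * (n - 1) * (n - 2) * (n - 3) * c.
Proof.
have E : distinct_sum4 (fun _ _ _ _ : 'I_N => c)
    = \sum_(k < N) \sum_(l < N | l != k)
      \sum_(m < N | (m != k) && (m != l)) ((n - 3) * c).
  apply: eq_bigr => k _; apply: eq_bigr => l lk; apply: eq_bigr => m mkl.
  by rewrite sum_neq3// sum_ord_cst; ring.
rewrite {}E (eq_bigr (fun=> (n - 1) * ((n - 2) * ((n - 3) * c)))).
  by rewrite sum_ord_cst; ring.
move=> k _; rewrite (eq_bigr (fun=> (n - 2) * ((n - 3) * c))).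
  by rewrite sum_neq1 sum_ord_cst; ring.
by move=> l lk; rewrite sum_neq2// sum_ord_cst; ring.
Qed.

End DistinctSums.

(** * Monomials and their sums over distinct sample indices *)

Definition exponents := (nat * nat * nat * nat)%type.

Definition add_exponents (e f : exponents) : exponents :=
  (e.1.1.1 + f.1.1.1, e.1.1.2 + f.1.1.2, e.1.2 + f.1.2, e.2 + f.2)%N.

Definition monomial (R : comNzRingType) (T : Type) (x y x' y' : T -> R)
    (e : exponents) (t : T) : R :=
  x t ^+ e.1.1.1 * y t ^+ e.1.1.2 * x' t ^+ e.1.2 * y' t ^+ e.2.

Lemma monomialD (R : comNzRingType) (T : Type) (x y x' y' : T -> R)
    (e f : exponents) (t : T) :
  monomial x y x' y' (add_exponents e f) t
  = monomial x y x' y' e t * monomial x y x' y' f t.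
Proof. by rewrite /monomial /= !exprD; ring. Qed.

Section MonomialSums.
Variables (R : comNzRingType) (N : nat) (x y x' y' : 'I_N -> R).
Local Notation mono := (monomial x y x' y').
Implicit Types e f g h : exponents.

Definition monomial_sum1 e := \sum_k mono e k.
Definition monomial_sum2 e f := distinct_sum2 (fun k l => mono e k * mono f l).
Definition monomial_sum3 e f g :=
  distinct_sum3 (fun k l m => mono e k * mono f l * mono g m).
Definition monomial_sum4 e f g h :=
  distinct_sum4 (fun k l m p => mono e k * mono f l * mono g m * mono h p).

(** Summing over an index that avoids the previous ones is summing freely and
subtracting the coincidences; a coincidence merges two monomials into one.
Iterating this turns sums over distinct indices into polynomials in the power
sums. *)
Lemma monomial_sum2E e f :
  monomial_sum2 e f
  = monomial_sum1 e * monomial_sum1 f - monomial_sum1 (add_exponents e f).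
Proof.
rewrite /monomial_sum1 mulr_suml -sumrB; apply: eq_bigr => k _.
by rewrite monomialD -mulr_sumr sum_neq1; ring.
Qed.

Lemma monomial_sum3E e f g :
  monomial_sum3 e f g
  = monomial_sum2 e f * monomial_sum1 g
    - monomial_sum2 (add_exponents e g) f
    - monomial_sum2 e (add_exponents f g).
Proof.
rewrite /monomial_sum1 /monomial_sum2 /distinct_sum2 mulr_suml -!sumrB.
apply: eq_bigr => k _; rewrite mulr_suml -!sumrB.
by apply: eq_bigr => l lk; rewrite !monomialD -mulr_sumr sum_neq2//; ring.
Qed.

Lemma monomial_sum4E e f g h :
  monomial_sum4 e f g h
  = monomial_sum3 e f g * monomial_sum1 h
    - monomial_sum3 (add_exponents e h) f g
    - monomial_sum3 e (add_exponents f h) g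
    - monomial_sum3 e f (add_exponents g h).
Proof.
rewrite /monomial_sum1 /monomial_sum3 /distinct_sum3 mulr_suml -!sumrB.
apply: eq_bigr => k _; rewrite mulr_suml -!sumrB.
apply: eq_bigr => l lk; rewrite mulr_suml -!sumrB.
by apply: eq_bigr => m mkl; rewrite !monomialD -mulr_sumr sum_neq3//; ring.
Qed.

End MonomialSums.

(** * The estimators as averages over distinct sample indices *)

Section KernelAverages.
Variables (R : realType) (N : nat) (x y x' y' : 'I_N -> R).
Local Notation n := (N%:R : R).
Local Notation s := (power_sum x y x' y').

Lemma power_sumE a b c d :
  monomial_sum1 x y x' y' (a, b, c, d) = s a b c d.
Proof. by []. Qed.

Lemma power_sum0 : s 0 0 0 0 = n.
Proof.
rewrite /power_sum; under eq_bigr do rewrite !expr0 !mulr1.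
by rewrite sum_ord_cst mulr1.
Qed.

(** The kernel [g k l = x_k y_k - x_k y_l - x'_k y'_k + x'_k y'_l]; each entry
is a sign, the exponents of the monomial at [k] and those of the monomial at
[l]. *)
Definition kernel_terms : seq (R * exponents * exponents) :=
  [:: (1%R, (1, 1, 0, 0), (0, 0, 0, 0)); ((-1)%R, (1, 0, 0, 0), (0, 1, 0, 0));
      ((-1)%R, (0, 0, 1, 1), (0, 0, 0, 0));
      (1%R, (0, 0, 1, 0), (0, 0, 0, 1))]%N.

Lemma level_covariance_differenceE : n != 0 -> n - 1 != 0 ->
  level_covariance_difference N s
  = (\sum_(a <- kernel_terms) a.1.1 * monomial_sum2 x y x' y' a.1.2 a.2) /
   ((n - 1) * n).
Proof.
move=> n0 n1; rewrite /level_covariance_difference.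
rewrite /kernel_terms !big_cons big_nil !monomial_sum2E /add_exponents /=.
rewrite !(addn0, add0n, add1n) !power_sumE power_sum0.
by field; rewrite n0 n1.
Qed.

(** After division by [(n - 3) (n - 2) (n - 1) ^ 2 n ^ 2] the first term on the
left is [Z ^ 2], and the term subtracted from it is the average of
[g k l * g m p] over quadruples of distinct indices. *)
Lemma variance_numeratorE :
  (n - 2) * (n - 3) *
   (\sum_(a <- kernel_terms) a.1.1 * monomial_sum2 x y x' y' a.1.2 a.2) ^+ 2
  - n * (n - 1) *
   (\sum_(a <- kernel_terms) \sum_(b <- kernel_terms) a.1.1 * b.1.1 *
       monomial_sum4 x y x' y' a.1.2 a.2 b.1.2 b.2)
  = variance_numerator N s.
Proof.
rewrite /kernel_terms !big_cons !big_nil /=.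
rewrite !monomial_sum4E !monomial_sum3E !monomial_sum2E /add_exponents /=.
rewrite !(addn0, add0n, add1n) !power_sumE power_sum0 /variance_numerator.
ring.
Qed.

End KernelAverages.

(** * Integration against a law given with a weight *)

Section WeightedLaw.
Context d d' (S : measurableType d) (T : measurableType d') (R : realType).
Variables (Q : {measure set S -> \bar R}) (P : {measure set T -> \bar R}).
Variables (w : S -> T) (mw : measurable_fun setT w).
Variables (h : S -> R) (mh : measurable_fun setT h).
Hypothesis h_ge0 : forall t, 0 <= h t.
Variable c : R.
Hypothesis weighted_law : forall A, measurable A ->
  (\int[Q]_t (\1_A (w t) * h t)%:E = c%:E * P A)%E.

Import HBNNSimple.

Lemma integral_weighted_nnsfun (f : {nnsfun T >-> R}) :
  (\int[Q]_t (f (w t) * h t)%:E = c%:E * \int[P]_x (f x)%:E)%E.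
Proof.
have m1 r : measurable_fun setT (fun t => (\1_(f @^-1` [set r]) (w t) : R)).
  exact: measurableT_comp.
have m2 r : measurable_fun setT
    (fun t => (\1_(f @^-1` [set r]) (w t) * h t : R)).
  exact: measurable_funM.
have E x : (f x)%:E = (\sum_(r \in range f) (r * \1_(f @^-1` [set r]) x)%:E)%E.
  by rewrite [in LHS]fimfunE -fsumEFin.
under [in RHS]eq_integral do rewrite E.
rewrite ge0_integral_fsum//; last 2 first.
  - by move=> r; apply/measurable_EFinP/measurable_funM.
  - by move=> r x _; rewrite EFinM nnfun_muleindic_ge0.
under eq_integral => t _.
  rewrite EFinM E muleC ge0_mule_fsumr; last first.
    by move=> r; rewrite EFinM nnfun_muleindic_ge0.
  over.
rewrite ge0_integral_fsum//; last 2 first.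
  - move=> r; apply/measurable_EFinP/measurable_funM => //.
    exact: measurable_funM.
  - move=> r t _; apply: mule_ge0; first by rewrite lee_fin.
    by rewrite EFinM nnfun_muleindic_ge0.
rewrite ge0_mule_fsumr; last first.
  by move=> r; apply: integral_ge0 => x _; rewrite EFinM nnfun_muleindic_ge0.
apply: eq_fsbigr => r; rewrite inE => -[x0 _ <-].
have f0 : 0 <= f x0 by [].
under eq_integral => t _.
  rewrite -EFinM mulrC -mulrA EFinM.
  over.
rewrite ge0_integralZl//; last 2 first.
  - exact/measurable_EFinP.
  - by move=> t _; rewrite lee_fin mulr_ge0.
rewrite weighted_law// integralZl_indic_nnsfun// integral_indic// setIT.
by rewrite muleCA.
Qed.

(** The weight [h] stands for the product of the functions of the other samples:
this is what lets a product of indicators be replaced, one sample at a time, by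
a product of functions. *)
Lemma integral_weighted (f : T -> R) :
  measurable_fun setT f -> (forall x, 0 <= f x) ->
  (\int[Q]_t (f (w t) * h t)%:E = c%:E * \int[P]_x (f x)%:E)%E.
Proof.
move=> mf f0.
have mEf : measurable_fun setT (EFin \o f) by exact/measurable_EFinP.
pose g := nnsfun_approx measurableT mEf.
have g_cvg x : (g n x)%:E @[n --> \oo] --> (f x)%:E.
  by apply: cvg_nnsfun_approx => //= y _; rewrite lee_fin.
have g_nd x a b : (a <= b)%N -> g a x <= g b x.
  by move=> ab; exact/lefP/nd_nnsfun_approx.
have cvgP : (\int[P]_x (g n x)%:E @[n --> \oo] --> \int[P]_x (f x)%:E)%E.
  rewrite (_ : (\int[P]_x _) =
    (\int[P]_x limn (fun n => (g n x)%:E)))%E; last first.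
    by apply: eq_integral => x _; apply/esym/cvg_lim.
  apply: cvg_monotone_convergence => //.
  - by move=> n; exact/measurable_EFinP.
  - by move=> n x _; rewrite lee_fin.
  - by move=> x _ a b ab; rewrite lee_fin g_nd.
have cvgQ : (\int[Q]_t (g n (w t) * h t)%:E @[n --> \oo]
             --> \int[Q]_t (f (w t) * h t)%:E)%E.
  rewrite (_ : (\int[Q]_t (f (w t) * h t)%:E) =
    (\int[Q]_t limn (fun n => (g n (w t) * h t)%:E)))%E; last first.
    apply: eq_integral => t _; apply/esym/cvg_lim => //.
    under eq_fun do rewrite EFinM.
    by rewrite EFinM; apply: cvgeZr.
  apply: cvg_monotone_convergence => //.
  - move=> n; apply/measurable_EFinP/measurable_funM => //.
    exact: measurableT_comp.
  - by move=> n x _; rewrite lee_fin mulr_ge0.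
  - by move=> x _ a b ab; rewrite lee_fin ler_wpM2r// g_nd.
rewrite -(cvg_lim _ cvgQ)// -(cvg_lim _ cvgP)// -limeMl//.
  by congr (limn _); apply/funext => n /=; rewrite integral_weighted_nnsfun.
by apply/cvg_ex; eexists; exact: cvgP.
Qed.

End WeightedLaw.

(** * Real-valued means *)

Section HasMean.
Context d (T : measurableType d) (R : realType).
Variable mu : {measure set T -> \bar R}.
Implicit Types (f g : T -> R) (m : R).

(** Integrability and the value of the integral are propagated together, so that
all computations of means take place in [R]. *)
Definition has_mean f m : Prop :=
  mu.-integrable setT (EFin \o f) /\ (\int[mu]_x (f x)%:E = m%:E)%E.

Lemma has_mean_measurable f m : has_mean f m -> measurable_fun setT f.
Proof. by move=> [/measurable_int/measurable_EFinP]. Qed.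

Lemma integrable_has_mean f : mu.-integrable setT (EFin \o f) ->
  has_mean f (fine (\int[mu]_x (f x)%:E)%E).
Proof.
by move=> fi; split=> //; rewrite fineK//; exact: integrable_fin_num.
Qed.

Lemma ge0_has_mean f m : measurable_fun setT f -> (forall x, 0 <= f x) ->
  (\int[mu]_x (f x)%:E = m%:E)%E -> has_mean f m.
Proof.
move=> mf f0 fm; split=> //; apply/integrableP; split.
  exact/measurable_EFinP.
under eq_integral => x _ do rewrite /= ger0_norm//.
by rewrite fm ltry.
Qed.

Lemma has_meanD f g m m' : has_mean f m -> has_mean g m' ->
  has_mean (fun x => f x + g x) (m + m').
Proof.
move=> [fi fm] [gi gm]; split.
  rewrite (_ : _ \o _ = ((EFin \o f) \+ (EFin \o g))%E)//.
  exact: integrableD.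
by rewrite EFinD -fm -gm; exact: (integralD measurableT fi gi).
Qed.

Lemma has_meanZ f m c : has_mean f m -> has_mean (fun x => c * f x) (c * m).
Proof.
move=> [fi fm]; split.
  rewrite (_ : _ \o _ = (fun x => c%:E * (EFin \o f) x)%E)//.
  exact: integrableZl.
by rewrite EFinM -fm; exact: (integralZl measurableT fi).
Qed.

Lemma has_meanB f g m m' : has_mean f m -> has_mean g m' ->
  has_mean (fun x => f x - g x) (m - m').
Proof.
move=> fm gm; rewrite -mulN1r.
rewrite (_ : (fun x => _) = fun x => f x + -1 * g x); last first.
  by apply/funext => x; rewrite mulN1r.
by apply: has_meanD => //; exact: has_meanZ.
Qed.

Lemma has_mean0 : has_mean (fun=> 0) 0.
Proof. by split; [exact: integrable0|rewrite integral0]. Qed.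

Lemma has_mean_sum I (r : seq I) (p : pred I) (f : I -> T -> R) (m : I -> R) :
  (forall i, p i -> has_mean (f i) (m i)) ->
  has_mean (fun x => \sum_(i <- r | p i) f i x) (\sum_(i <- r | p i) m i).
Proof.
move=> fm; elim: r => [|i r ih].
  by rewrite big_nil; under eq_fun do rewrite big_nil; exact: has_mean0.
rewrite big_cons; under eq_fun do rewrite big_cons.
by case: ifPn => // /fm fim; exact: has_meanD fim ih.
Qed.

End HasMean.

Lemma has_mean_cst d (T : measurableType d) (R : realType)
  (P : probability T R) (c : R) : has_mean P (fun=> c) c.
Proof.
split; first exact: finite_measure_integrable_cst.
by rewrite integral_cst//= probability_setT mule1.
Qed.

(** * Products of functions of independent samples *)

Section IndependentProducts.
Context d d' (S : measurableType d) (T : measurableType d') (R : realType).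
Variables (Q : probability S R) (P : probability T R) (n : nat).
Variable v : 'I_n -> {RV Q >-> T}.
Hypothesis joint_law : forall A : 'I_n -> set T, (forall j, measurable (A j)) ->
  Q (\bigcap_j (v j @^-1` A j)) = (\prod_j P (A j))%E.
Implicit Types (f : 'I_n -> T -> R) (m : 'I_n -> R).

Lemma measurable_prod_samples f : (forall j, measurable_fun setT (f j)) ->
  forall p : pred 'I_n,
    measurable_fun setT (fun t => \prod_(j | p j) f j (v j t)).
Proof.
move=> mf p; under eq_fun do rewrite big_mkcond.
apply: measurable_prod => j _; case: (p j); last exact: measurable_cst.
by apply: measurableT_comp.
Qed.

Lemma has_mean_prod_indic (A : 'I_n -> set T) m :
    (forall j, measurable (A j)) -> (forall j, P (A j) = (m j)%:E) ->
  has_mean Q (fun t => \prod_j \1_(A j) (v j t)) (\prod_j m j).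
Proof.
move=> mA Am.
have E t : \prod_j \1_(A j) (v j t) = \1_(\bigcap_j (v j @^-1` A j)) t :> R.
  rewrite [RHS]indicE; case: (boolP (t \in _)) => [|].
    move=> /set_mem At; rewrite big1// => j _.
    by rewrite indicE mem_set//; exact: At.
  move=> /negP At; have [j Ajt] : exists j, ~ A j (v j t).
    by apply/existsNP => At'; apply/At/mem_set => j _; exact: At'.
  by rewrite (bigD1 j)//= indicE memNset// mul0r.
have mAv : measurable (\bigcap_j (v j @^-1` A j)).
  apply: fin_bigcap_measurable => // j _.
  by rewrite -[_ @^-1` _]setTI; exact: measurable_funPT.
apply: ge0_has_mean.
- apply: (@measurable_prod_samples (fun j => \1_(A j)) _ xpredT) => j.
  exact: measurable_indic.
- by move=> t; apply: prodr_ge0.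
under eq_integral do rewrite E.
rewrite integral_indic// setIT -prodEFin; apply: etrans (joint_law mA) _.
by apply: eq_bigr.
Qed.

(** Induction on the list [s] of samples carrying a general function instead of
an indicator: independence gives the case of indicators, and the step is
[integral_weighted] with the product over the other samples as weight. *)
Lemma ge0_has_mean_prod_aux (s : seq 'I_n) f m :
    (forall j, has_mean P (f j) (m j)) -> (forall j x, 0 <= f j x) ->
    (forall j, j \notin s -> exists2 A, measurable A & f j = \1_A) ->
  has_mean Q (fun t => \prod_j f j (v j t)) (\prod_j m j).
Proof.
elim: s f m => [|i s ih] f m fm f0 fA.
  have /choice[A mAf] : forall j, exists A, measurable A /\ f j = \1_A.
    by move=> j; have [//|A] := fA j; exists A.
  rewrite (_ : (fun t => _) = fun t => \prod_j \1_(A j) (v j t)); last first.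
    by apply/funext => t; apply: eq_bigr => j _; rewrite (mAf j).2.
  apply: has_mean_prod_indic => j; first exact: (mAf j).1.
  have [_ <-] := fm j; rewrite (mAf j).2 integral_indic ?setIT//.
  exact: (mAf j).1.
have mf j : measurable_fun setT (f j) := has_mean_measurable (fm j).
pose h t := \prod_(j | j != i) f j (v j t).
have h0 t : 0 <= h t by apply: prodr_ge0 => j _.
have mh : measurable_fun setT h by exact: (measurable_prod_samples mf).
have fE t : \prod_j f j (v j t) = f i (v i t) * h t by rewrite (bigD1 i).
apply: ge0_has_mean; first exact: (measurable_prod_samples mf xpredT).
  by move=> t; apply: prodr_ge0.
under eq_integral do rewrite fE.
rewrite (@integral_weighted _ _ _ _ _ Q P (v i) _ h mh h0
  (\prod_(j | j != i) m j))//.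
  by rewrite (fm i).2 [in RHS](bigD1 i)//= EFinM muleC.
move=> A mA.
pose f' j := if j == i then \1_A else f j.
pose m' j := if j == i then fine (P A) else m j.
have PA : (P A = (fine (P A))%:E)%E by rewrite fineK// fin_num_measure.
have fm' j : has_mean P (f' j) (m' j).
  rewrite /f' /m'; case: eqP => // _; apply: ge0_has_mean => //.
  by rewrite integral_indic// setIT.
have [||_] := ih f' m' fm'.
- by move=> j x; rewrite /f'; case: eqP.
- move=> j js; rewrite /f'; case: eqVneq => [_|ji]; first by exists A.
  by apply: fA; rewrite inE negb_or ji.
rewrite (bigD1 i)//= {1}/m' eqxx EFinM -PA muleC.
rewrite (eq_bigr m) => [<-|j /negbTE ji]; last by rewrite /m' ji.
apply: eq_integral => t _; rewrite (bigD1 i)//= {1}/f' eqxx.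
by congr (_ * _)%:E; apply: eq_bigr => j /negbTE ji; rewrite /f' ji.
Qed.

(** Induction on the list [s] of samples whose function may change sign: one
factor at a time is split into its positive and negative parts, and the product
is linear in each factor. *)
Lemma has_mean_prod_aux (s : seq 'I_n) f m :
    (forall j, has_mean P (f j) (m j)) ->
    (forall j, j \notin s -> forall x, 0 <= f j x) ->
  has_mean Q (fun t => \prod_j f j (v j t)) (\prod_j m j).
Proof.
elim: s f m => [|i s ih] f m fm f0.
  apply: (@ge0_has_mean_prod_aux (enum 'I_n)) => //.
  - by move=> j x; exact: f0.
  - by move=> j; rewrite mem_enum.
pose fs g j := if j == i then g else f j.
pose ms a j := if j == i then a else m j.
have step g a : has_mean P g a -> (forall x, 0 <= g x) ->
    has_mean Q (fun t => \prod_j fs g j (v j t)) (\prod_j ms a j).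
  move=> ga g0; apply: ih => j; first by rewrite /fs /ms; case: eqP.
  move=> js x; rewrite /fs; case: eqVneq => // ji.
  by apply: f0; rewrite inE negb_or ji.
have fsE g t :
    \prod_j fs g j (v j t) = g (v i t) * \prod_(j | j != i) f j (v j t).
  rewrite (bigD1 i)//= {1}/fs eqxx.
  by congr (_ * _); apply: eq_bigr => j /negbTE ji; rewrite /fs ji.
have msE a : \prod_j ms a j = a * \prod_(j | j != i) m j.
  rewrite (bigD1 i)//= {1}/ms eqxx.
  by congr (_ * _); apply: eq_bigr => j /negbTE ji; rewrite /ms ji.
have [fi _] := fm i.
have pos := integrable_has_mean (integrable_funrpos measurableT fi).
have neg := integrable_has_mean (integrable_funrneg measurableT fi).
have := has_meanB (step _ _ pos (funrpos_ge0 _)) (step _ _ neg (funrneg_ge0 _)).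
rewrite !msE -mulrBl (_ : _ - _ = m i) => [|].
  have <- : \prod_j m j = m i * \prod_(j | j != i) m j by rewrite (bigD1 i).
  congr (has_mean _ _ _).
  apply/funext => t.
  rewrite !fsE -mulrBl [RHS](bigD1 i)//=; congr (_ * _).
  by rewrite -[in RHS](funrposBneg (f i)).
apply: EFin_inj; rewrite -(has_meanB pos neg).2 -(fm i).2.
by apply: eq_integral => x _; rewrite -[in RHS](funrposBneg (f i)).
Qed.

End IndependentProducts.

Section IndependentSamples.
Context d d' (S : measurableType d) (T : measurableType d') (R : realType).
Variables (Q : probability S R) (P : probability T R) (N : nat).
Variable w : 'I_N -> {RV Q >-> T}.
Hypothesis w_indep : independent_samples P w.

(** Mutual independence concerns families of events indexed by the samples, so
the event attached to a sample outside the image of [tau] is taken to be the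
whole space. *)
Lemma joint_law_injective n (tau : 'I_n -> 'I_N) (A : 'I_n -> set T) :
    injective tau -> (forall j, measurable (A j)) ->
  Q (\bigcap_j (w (tau j) @^-1` A j)) = (\prod_j P (A j))%E.
Proof.
move=> tau_inj mA; have [w_law w_ind] := w_indep.
pose A' k := if [pick j | tau j == k] is Some j then A j else setT.
have A'E j : A' (tau j) = A j.
  rewrite /A'; case: pickP => [i /eqP/tau_inj -> //|/(_ j)].
  by rewrite eqxx.
have mA' k : measurable (A' k) by rewrite /A'; case: pickP.
have := w_ind [set tau j | j in 'I_n]%SET A' (fun k _ => mA' k).
rewrite big_imset/=; last by move=> i j _ _; exact: tau_inj.
rewrite (eq_bigr (fun j => P (A j))) => [<-|j _]; last first.
  by rewrite A'E; exact: w_law.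
congr (Q _); apply/seteqP; split => [t At k /= /imsetP[j _ ->]|t At j _].
  by rewrite A'E; exact: At.
by have := At (tau j); rewrite /= A'E; apply; exact: imset_f.
Qed.

Lemma has_mean_prod_samples n (tau : 'I_n -> 'I_N)
    (f : 'I_n -> T -> R) (m : 'I_n -> R) :
    injective tau -> (forall j, has_mean P (f j) (m j)) ->
  has_mean Q (fun t => \prod_j f j (w (tau j) t)) (\prod_j m j).
Proof.
move=> tau_inj fm.
apply: (@has_mean_prod_aux _ _ _ _ _ Q P n (fun j => w (tau j)) _
  (enum 'I_n)) => //.
- by move=> A; exact: joint_law_injective.
- by move=> j; rewrite mem_enum.
Qed.

Lemma nth_ord_inj n k0 (r : seq 'I_N) : uniq r -> size r = n ->
  injective (fun j : 'I_n => nth k0 r j).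
Proof.
move=> r_uniq rn i j /eqP; rewrite nth_uniq ?rn ?ltn_ord//.
by move=> /eqP; exact: val_inj.
Qed.

Lemma has_mean_mul2 (a b : T -> R) (ma mb : R) k l : l != k ->
    has_mean P a ma -> has_mean P b mb ->
  has_mean Q (fun t => a (w k t) * b (w l t)) (ma * mb).
Proof.
move=> lk am bm.
pose tau (j : 'I_2) := nth k [:: k; l] j.
pose f (j : 'I_2) := nth a [:: a; b] j.
pose m (j : 'I_2) := nth ma [:: ma; mb] j.
have -> : ma * mb = \prod_j m j by rewrite !big_ord_recl big_ord0 mulr1.
have -> : (fun t => a (w k t) * b (w l t))
    = fun t => \prod_j f j (w (tau j) t).
  by apply/funext => t; rewrite !big_ord_recl big_ord0 mulr1.
apply: has_mean_prod_samples; last by move=> [[|[|]]].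
by apply: nth_ord_inj; rewrite //= inE eq_sym lk.
Qed.

Lemma has_mean_mul4 (a b c e : T -> R) (ma mb mc me : R) k l m p :
    l != k -> (m != k) && (m != l) -> [&& p != k, p != l & p != m] ->
    has_mean P a ma -> has_mean P b mb -> has_mean P c mc -> has_mean P e me ->
  has_mean Q (fun t => a (w k t) * b (w l t) * c (w m t) * e (w p t))
    (ma * mb * mc * me).
Proof.
move=> lk /andP[mk ml] /and3P[pk pl pm] am bm cm em.
pose tau (j : 'I_4) := nth k [:: k; l; m; p] j.
pose f (j : 'I_4) := nth a [:: a; b; c; e] j.
pose mean (j : 'I_4) := nth ma [:: ma; mb; mc; me] j.
have -> : ma * mb * mc * me = \prod_j mean j.
  by rewrite !big_ord_recl big_ord0 mulr1 !mulrA.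
have -> : (fun t => a (w k t) * b (w l t) * c (w m t) * e (w p t))
    = fun t => \prod_j f j (w (tau j) t).
  by apply/funext => t; rewrite !big_ord_recl big_ord0 mulr1 !mulrA.
apply: has_mean_prod_samples; last by move=> [[|[|[|[|]]]]].
apply: nth_ord_inj => //=; rewrite !inE !negb_or.
rewrite (eq_sym k l) (eq_sym k m) (eq_sym k p) (eq_sym l m) (eq_sym l p).
by rewrite (eq_sym m p) lk mk ml pk pl pm.
Qed.

End IndependentSamples.

(** * Perturbing a possibly infinite integral *)

(** If [f] is integrable, this is additivity.  If the integral of [f] is
infinite, then so is that of the positive part of [f + h], because
[f <= (f + h)^+ + |h|], while the negative part is at most [|h|]. *)
Lemma integralD_ge0_mean0 d (T : measurableType d) (R : realType)
    (mu : {measure set T -> \bar R}) (f h : T -> R) :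
    measurable_fun setT f -> (forall x, 0 <= f x) -> has_mean mu h 0 ->
  (\int[mu]_x (f x + h x)%:E = \int[mu]_x (f x)%:E)%E.
Proof.
move=> mf f0 hm; have [hi _] := hm.
have If0 : (0 <= \int[mu]_x (f x)%:E)%E.
  by apply: integral_ge0 => x _; rewrite lee_fin.
have [foo|] := ltP (\int[mu]_x (f x)%:E)%E +oo%E.
  have Iff : (\int[mu]_x (f x)%:E \is a fin_num)%E by rewrite ge0_fin_numE.
  have fm : has_mean mu f (fine (\int[mu]_x (f x)%:E)%E).
    by apply: ge0_has_mean => //; rewrite fineK.
  by rewrite (has_meanD fm hm).2 addr0 fineK.
rewrite leye_eq => /eqP foo; rewrite foo.
have mh := has_mean_measurable hm.
have /integrableP[mEh hoo] := hi.
pose g x := (f x + h x)%:E.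
have mg : measurable_fun setT g.
  by apply/measurable_EFinP; exact: measurable_funD.
have gneg : (\int[mu]_x g^\- x < +oo)%E.
  apply: le_lt_trans hoo; apply: ge0_le_integral => //.
  - exact: measurable_funeneg.
  - exact: measurableT_comp.
  - move=> x _; rewrite funenegE /g -EFinN -EFin_max lee_fin.
    have := f0 x; have := ler_norm (- h x).
    rewrite normrN ge_max normr_ge0 andbT.
    by move=> /= *; lra.
have gpos : (\int[mu]_x g^\+ x = +oo)%E.
  apply/eqP; rewrite -leye_eq; have := hoo; apply: contraTT.
  rewrite -ltNge => gpoo; rewrite -leNgt leye_eq; apply/eqP.
  have : (\int[mu]_x (f x)%:E <= \int[mu]_x (g^\+ x + `|(EFin \o h) x|))%E.
    apply: ge0_le_integral => //.
    - by move=> x _; rewrite lee_fin.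
    - exact/measurable_EFinP.
    - apply: emeasurable_funD; first exact: measurable_funepos.
      exact: measurableT_comp.
    - move=> x _; rewrite funeposE /g -EFin_max /= -EFinD lee_fin.
      have := ler_norm (- h x); rewrite normrN => hx.
      have : f x + h x <= Num.max (f x + h x) 0 by rewrite le_max lexx.
      by move: hx => *; lra.
  rewrite foo leye_eq ge0_integralD//; last 2 first.
    - exact: measurable_funepos.
    - exact: measurableT_comp.
  move=> /eqP; case: (\int[mu]_x g^\+ x)%E gpoo => [r| |]//= _.
  by case: (\int[mu]_x _)%E.
rewrite integralE gpos; move: gneg.
have : (0 <= \int[mu]_x g^\- x)%E by exact: integral_ge0.
by case: (\int[mu]_x g^\- x)%E.
Qed.

(** * Consequences of a finite variance *)

Section SecondMoments.
Context d (T : measurableType d) (R : realType) (P : probability T R).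
Implicit Types X Y : T -> R.

Lemma finite_variance_sqr_integrable X : finite_variance P X ->
  P.-integrable setT (fun t => (X t ^+ 2)%:E).
Proof.
move=> [mX]; rewrite /variance unlock unlock; set c := fine _ => Xoo.
have mY : measurable_fun setT (fun t => (X t - c) ^+ 2).
  by apply: measurable_funX; apply: measurable_funB.
have Yi : P.-integrable setT (fun t => ((X t - c) ^+ 2)%:E).
  apply/integrableP; split; first exact/measurable_EFinP.
  apply: le_lt_trans Xoo; rewrite le_eqVlt; apply/orP; left; apply/eqP.
  by apply: eq_integral => t _; rewrite /= ger0_norm ?sqr_ge0// expr2.
(* X ^ 2 <= 2 (X - c) ^ 2 + 2 c ^ 2, since (X - 2 c) ^ 2 >= 0 *)
have := has_meanD (has_meanZ 2 (integrable_has_mean Yi))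
  (has_mean_cst P (2 * c ^+ 2)).
move=> [bi _]; apply: le_integrable bi => //.
  by apply/measurable_EFinP; exact: measurable_funX.
move=> t _; rewrite /= lee_fin !ger0_norm ?sqr_ge0//.
  by have := sqr_ge0 (X t - 2 * c); rewrite !expr2; nra.
by have := sqr_ge0 (X t - c); have := sqr_ge0 c; rewrite !expr2; nra.
Qed.

Lemma finite_variance_mul_integrable X Y :
    finite_variance P X -> finite_variance P Y ->
  P.-integrable setT (fun t => (X t * Y t)%:E).
Proof.
move=> fX fY; have [[mX _] [mY _]] := (fX, fY).
have [bi _] := has_meanD
  (integrable_has_mean (finite_variance_sqr_integrable fX))
  (integrable_has_mean (finite_variance_sqr_integrable fY)).
apply: le_integrable bi => //.
  by apply/measurable_EFinP; exact: measurable_funM.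
move=> t _; rewrite /= lee_fin [leRHS]ger0_norm ?addr_ge0 ?sqr_ge0//.
rewrite ler_norml.
have := sqr_ge0 (X t - Y t); have := sqr_ge0 (X t + Y t).
have := sqr_ge0 (X t); have := sqr_ge0 (Y t).
by rewrite !expr2 => *; apply/andP; split; nra.
Qed.

Lemma finite_variance_cst c : finite_variance P (fun=> c).
Proof.
split; first exact: measurable_cst.
by rewrite (_ : (fun=> c) = cst c)// variance_cst.
Qed.

Lemma finite_variance_integrable X : finite_variance P X ->
  P.-integrable setT (EFin \o X).
Proof.
move=> /finite_variance_mul_integrable/(_ (finite_variance_cst 1)).
by rewrite (_ : (fun t => _) = EFin \o X)//; apply/funext => t; rewrite mulr1.
Qed.

End SecondMoments.

(** * Unbiasedness of the variance estimator *)

Section SampleMonomials.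
Context d d' (S : measurableType d) (T : measurableType d') (R : realType).
Variables (Q : probability S R) (P : probability T R) (N : nat).
Variable w : 'I_N -> {RV Q >-> T}.
Hypothesis w_indep : independent_samples P w.
Variables x y x' y' : T -> R.
Local Notation n := (N%:R : R).
Local Notation at_samples F t := (F (fun k => x (w k t)) (fun k => y (w k t))
  (fun k => x' (w k t)) (fun k => y' (w k t))).
Local Notation mono := (monomial x y x' y').

Lemma has_mean_monomial_sum2 e f (me mf : R) :
    has_mean P (mono e) me -> has_mean P (mono f) mf ->
  has_mean Q (fun t => at_samples (@monomial_sum2 R N) t e f)
    (n * (n - 1) * (me * mf)).
Proof.
move=> em fm; rewrite -distinct_sum2_cst.
apply: has_mean_sum => k _; apply: has_mean_sum => l lk.
exact: (has_mean_mul2 w_indep lk em fm).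
Qed.

Lemma has_mean_monomial_sum4 e f g h (me mf mg mh : R) :
    has_mean P (mono e) me -> has_mean P (mono f) mf ->
    has_mean P (mono g) mg -> has_mean P (mono h) mh ->
  has_mean Q (fun t => at_samples (@monomial_sum4 R N) t e f g h)
    (n * (n - 1) * (n - 2) * (n - 3) * (me * mf * mg * mh)).
Proof.
move=> em fm gm hm; rewrite -distinct_sum4_cst.
apply: has_mean_sum => k _; apply: has_mean_sum => l lk.
apply: has_mean_sum => m mkl; apply: has_mean_sum => p pklm.
exact: (has_mean_mul4 w_indep lk mkl pklm em fm gm hm).
Qed.

Hypothesis (fx : finite_variance P x) (fy : finite_variance P y).
Hypothesis (fx' : finite_variance P x') (fy' : finite_variance P y').

Let M e : R := fine (\int[P]_s (mono e s)%:E)%E.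

(** The kernel multiplies at most two of the functions at one sample, so that
finite second moments suffice. *)
Lemma kernel_terms_has_mean a : a \in kernel_terms R ->
  has_mean P (mono a.1.2) (M a.1.2) /\ has_mean P (mono a.2) (M a.2).
Proof.
have m0 : P.-integrable setT (EFin \o mono (0, 0, 0, 0)%N).
  apply: eq_integrable
    (finite_variance_integrable (finite_variance_cst P 1)) => //.
  by move=> t _; rewrite /= /monomial/= !expr0 !mulr1.
have m1 (z : T -> R) e : finite_variance P z -> mono e =1 z ->
    P.-integrable setT (EFin \o mono e).
  by move=> /finite_variance_integrable fz ez; rewrite (funext ez).
have m2 (z z' : T -> R) e : finite_variance P z -> finite_variance P z' ->
    (forall t, mono e t = z t * z' t) -> P.-integrable setT (EFin \o mono e).
  move=> fz fz' ez; rewrite (funext ez).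
  exact: finite_variance_mul_integrable.
rewrite !inE => /or4P[] /eqP -> /=; split; apply: integrable_has_mean => //.
- by apply: (m2 x y) => // t; rewrite /monomial /= !expr1 !expr0; ring.
- by apply: (m1 x) => // t; rewrite /monomial /= !expr1 !expr0; ring.
- by apply: (m1 y) => // t; rewrite /monomial /= !expr1 !expr0; ring.
- by apply: (m2 x' y') => // t; rewrite /monomial /= !expr1 !expr0; ring.
- by apply: (m1 x') => // t; rewrite /monomial /= !expr1 !expr0; ring.
- by apply: (m1 y') => // t; rewrite /monomial /= !expr1 !expr0; ring.
Qed.

(** The mean of the kernel at two independent samples. *)
Definition kernel_mean : R :=
  \sum_(a <- kernel_terms R) a.1.1 * (M a.1.2 * M a.2).

Lemma has_mean_kernel2 :
  has_mean Q (fun t => \sum_(a <- kernel_terms R)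
      a.1.1 * at_samples (@monomial_sum2 R N) t a.1.2 a.2)
    (n * (n - 1) * kernel_mean).
Proof.
rewrite /kernel_mean mulr_sumr big_seq.
under eq_fun do rewrite big_seq.
apply: has_mean_sum => a /kernel_terms_has_mean[am am'].
by rewrite mulrCA; apply: has_meanZ; exact: has_mean_monomial_sum2.
Qed.

Lemma has_mean_kernel4 :
  has_mean Q (fun t => \sum_(a <- kernel_terms R) \sum_(b <- kernel_terms R)
      a.1.1 * b.1.1 * at_samples (@monomial_sum4 R N) t a.1.2 a.2 b.1.2 b.2)
    (n * (n - 1) * (n - 2) * (n - 3) * kernel_mean ^+ 2).
Proof.
rewrite expr2 /kernel_mean mulr_suml mulr_sumr big_seq.
under eq_fun do rewrite big_seq.
apply: has_mean_sum => a /kernel_terms_has_mean[am am'].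
rewrite mulr_sumr mulr_sumr big_seq.
under eq_fun do rewrite big_seq.
apply: has_mean_sum => b /kernel_terms_has_mean[bm bm'].
have := has_meanZ (a.1.1 * b.1.1) (has_mean_monomial_sum4 am am' bm bm').
by congr (has_mean _ _ _); ring.
Qed.

Lemma estimator_unbiased : (3 < N)%N ->
  let s := fun t => at_samples (@power_sum R N) t in
  ('E_Q[fun t => mc_variance_estimator N (s t)] =
   'V_Q[fun t => level_covariance_difference N (s t)])%E.
Proof.
move=> N3 s.
have n0 : n != 0 by rewrite pnatr_eq0 -lt0n; lia.
have n1 : n - 1 != 0 by rewrite subr_eq0 (eqr_nat R N 1); apply/eqP; lia.
have n2 : n - 2 != 0 by rewrite subr_eq0 (eqr_nat R N 2); apply/eqP; lia.
have n3 : n - 3 != 0 by rewrite subr_eq0 (eqr_nat R N 3); apply/eqP; lia.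
pose K2 t := \sum_(a <- kernel_terms R)
  a.1.1 * at_samples (@monomial_sum2 R N) t a.1.2 a.2.
pose K4 t := \sum_(a <- kernel_terms R) \sum_(b <- kernel_terms R)
  a.1.1 * b.1.1 * at_samples (@monomial_sum4 R N) t a.1.2 a.2 b.1.2 b.2.
pose Z t := level_covariance_difference N (s t).
pose U t := (n * (n - 1) * (n - 2) * (n - 3))^-1 * K4 t.
have ZE t : Z t = ((n - 1) * n)^-1 * K2 t.
  by rewrite /Z level_covariance_differenceE// mulrC.
have Zm : has_mean Q Z kernel_mean.
  have := has_meanZ ((n - 1) * n)^-1 has_mean_kernel2.
  rewrite -(funext ZE); congr (has_mean _ _ _); field.
  by rewrite n0 n1.
have Um : has_mean Q U (kernel_mean ^+ 2).
  have := has_meanZ (n * (n - 1) * (n - 2) * (n - 3))^-1 has_mean_kernel4.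
  congr (has_mean _ _ _); field.
  by rewrite n0 n1 n2 n3.
have VE t : mc_variance_estimator N (s t) = Z t ^+ 2 - U t.
  rewrite ZE /U /mc_variance_estimator -variance_numeratorE.
  rewrite -/(K2 t) -/(K4 t); field.
  by rewrite n0 n1 n2 n3.
set c := kernel_mean in Zm Um.
(* the variance estimator Z ^ 2 - U is (Z - c) ^ 2 + H *)
pose H t := 2 * c * Z t - (c ^+ 2 + U t).
have Hm : has_mean Q H 0.
  have := has_meanB (has_meanZ (2 * c) Zm)
    (has_meanD (has_mean_cst Q (c ^+ 2)) Um).
  by congr (has_mean _ _ _); ring.
have EZ : ('E_Q[Z] = c%:E)%E by rewrite unlock; exact: Zm.2.
rewrite -[fun t => level_covariance_difference N (s t)]/Z.
rewrite /variance covariance.unlock EZ expectation.unlock /=.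
have mZ := has_mean_measurable Zm.
rewrite -[RHS](@integralD_ge0_mean0 _ _ _ Q _ H)//.
- apply: eq_integral => t _; rewrite VE /H /=; congr (_%:E).
  by rewrite !fctE /=; ring.
- by apply: measurable_funM; apply: measurable_funB.
- by move=> t; rewrite -expr2 sqr_ge0.
Qed.

End SampleMonomials.

Theorem mainTheorem2 (R : realType)
    (dO : measure_display) (Omega : measurableType dO) (P : probability Omega R)
    (dim : nat) (G : set 'rV[R]_dim)
    (L : nat) (u : nat -> 'rV[R]_dim -> Omega -> R)
    (l : nat) (l_gt0 : (0 < l)%N) (l_le_L : (l <= L)%N)
    (xi xj : 'rV[R]_dim) (Gxi : G xi) (Gxj : G xj)
    (fv_fine_i : finite_variance P (u l xi))
    (fv_fine_j : finite_variance P (u l xj))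
    (fv_coarse_i : finite_variance P (u l.-1 xi))
    (fv_coarse_j : finite_variance P (u l.-1 xj))
    (N : nat) (N_gt3 : (3 < N)%N)
    (dS : measure_display) (S : measurableType dS) (Q : probability S R)
    (omega : 'I_N -> {RV Q >-> Omega})
    (omega_indep : independent_samples P omega) :
  let s := fun t : S =>
    power_sum (fun k => u l xi (omega k t)) (fun k => u l xj (omega k t))
              (fun k => u l.-1 xi (omega k t)) (fun k => u l.-1 xj (omega k t))
  in
  ('E_Q[fun t => mc_variance_estimator N (s t)] =
   'V_Q[fun t => level_covariance_difference N (s t)])%E.
Proof.
exact (estimator_unbiased omega_indep fv_fine_i fv_fine_j fv_coarse_i
  fv_coarse_j N_gt3).
Qed.
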